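(* Let $\mathcal{A}$ be a well-founded poset and let $G:\mathcal{A}\to\mathbf{IHilb}$ be a functor. Then $G$ is decomposable if and only if $G$ satisfies the intersection property (I'), i.e. for all $\alpha,a,b\in\mathcal{A}$ with $a\le\alpha$ and $b\le\alpha$, $$\pi^{\alpha}(\hat a\cap\hat b)=\pi^{\alpha}(\hat a)\,\pi^{\alpha}(\hat b).$$
   Context: $\mathbb{K}=\mathbb{R}$ or $\mathbb{C}$. $\mathbf{IHilb}$ is the category whose objects are $\mathbb{K}$-Hilbert spaces and whose morphisms are linear isometries (not necessarily surjective). For a functor $G$ from a poset $\mathcal{A}$ (viewed as a category) and $b\le a$, write $G^b_a=G(b\le a)$. A poset is well-founded if every strictly decreasing sequence of its elements terminates. For $a\in\mathcal{A}$, $\hat a=\{b\in\mathcal{A}: b\le a\}$; a lower set is a subset $\mathcal{B}$ with $c\le b\in\mathcal{B}\Rightarrow c\in\mathcal{B}$. Intersection property (I'): for $\alpha\in\mathcal{A}$ and a lower set $\mathcal{B}\subseteq\hat\alpha$, let $G^{\alpha}(\mathcal{B})$ be the closure in $G(\alpha)$ of $\sum_{a\in\mathcal{B}}\operatorname{im}G^a_\alpha$ (the zero space if $\mathcal B=\emptyset$), and let $\pi^{\alpha}(\mathcal{B})$ be the orthogonal projection of $G(\alpha)$ onto $G^{\alpha}(\mathcal{B})$. $G$ satisfies (I') if $\pi^{\alpha}(\hat a\cap\hat b)=\pi^{\alpha}(\hat a)\pi^{\alpha}(\hat b)$ for all $\alpha$ and all $a,b\le\alpha$. Decomposability: $G$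 is decomposable if there is a family $(S_c)_{c\in\mathcal{A}}$ of functors $S_c:\mathcal{A}\to\mathbf{IHilb}$ all of whose morphisms are isometric isomorphisms (unitaries), such that $G$ is naturally isomorphic (via unitaries) to the functor $T:\mathcal{A}\to\mathbf{IHilb}$ defined by: $T(a)$ is the Hilbert direct sum (completion of the orthogonal algebraic direct sum) $\widehat{\bigoplus}_{c\le a}S_c(a)$, and for $b\le a$, $T(b\le a)$ sends $(v_c)_{c\le b}$ to $(w_c)_{c\le a}$ with $w_c=S_c(b\le a)(v_c)$ for $c\le b$ and $w_c=0$ for $c\le a$, $c\not\le b$ (extended by continuity). Natural isomorphism means: there are unitaries $\phi_a:G(a)\to T(a)$ with $\phi_aG^b_a=T(b\le a)\phi_b$ for all $b\le a$. *)

(* Defs.v *)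
From HB Require Import structures.
From mathcomp Require Import all_boot all_order all_algebra.
From mathcomp Require Import reals.
From mathcomp.real_closed Require Import complex.
From Stdlib Require Import ClassicalEpsilon.

Set Implicit Arguments.
Unset Strict Implicit.
Unset Printing Implicit Defensive.

Import Order.TTheory GRing.Theory Num.Theory.
Local Open Scope ring_scope.

Inductive scalar_field (R : realType) : forall K : numFieldType, (K -> K) -> Prop :=
  | SF_real : @scalar_field R R idfun
  | SF_complex : @scalar_field R R[i] Num.conj.

Section Hilbert.
Variables (K : numFieldType) (conjK : K -> K).

Record hilb := Hilb {
  hV :> lmodType K;
  hip : hV -> hV -> K;
  hip_linl : forall (a : K) (x y z : hV), hip (a *: x + y) z = a * hip x z + hip y z;
  hip_sym : forall x y : hV, hip x y = conjK (hip y x);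
  hip_ge0 : forall x : hV, 0 <= hip x x;
  hip_eq0 : forall x : hV, hip x x = 0 -> x = 0;
  hip_complete : forall u : nat -> hV,
    (forall eps : K, 0 < eps -> exists N : nat, forall m n : nat,
        (N <= m)%N -> (N <= n)%N -> hip (u m - u n) (u m - u n) < eps) ->
    exists l : hV, forall eps : K, 0 < eps -> exists N : nat, forall n : nat,
        (N <= n)%N -> hip (u n - l) (u n - l) < eps
}.

Definition nsq (H : hilb) (x : H) : K := hip x x.

Definition lin_isometry (H1 H2 : hilb) (f : H1 -> H2) : Prop :=
  (forall (a : K) (x y : H1), f (a *: x + y) = a *: f x + f y) /\
  (forall x : H1, nsq (f x) = nsq x).

Definition unitary (H1 H2 : hilb) (f : H1 -> H2) : Prop :=
  lin_isometry f /\ bijective f.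

Definition hclosure (H : hilb) (S : H -> Prop) : H -> Prop :=
  fun x => forall eps : K, 0 < eps -> exists y : H, S y /\ nsq (x - y) < eps.

Definition orthproj (H : hilb) (S : H -> Prop) (x : H) : H :=
  epsilon (inhabits (0 : H))
    (fun p => S p /\ forall y : H, S y -> hip (x - p) y = 0).

Section Functor.
Variables (d : Order.disp_t) (A : porderType d).

Record IHfunctor := IHFunctor {
  Fobj :> A -> hilb;
  Fmor : forall b a : A, (b <= a)%O -> Fobj b -> Fobj a;
  Fmor_isometry : forall (b a : A) (h : (b <= a)%O), lin_isometry (Fmor h);
  Fmor_id : forall (a : A) (h : (a <= a)%O) (x : Fobj a), Fmor h x = x;
  Fmor_comp : forall (c b a : A) (hcb : (c <= b)%O) (hba : (b <= a)%O)
      (hca : (c <= a)%O) (x : Fobj c), Fmor hca x = Fmor hba (Fmor hcb x)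
}.

Definition well_founded_poset : Prop :=
  forall f : nat -> A, ~ (forall n : nat, (f n.+1 < f n)%O).

Definition lower_hat (a : A) : A -> Prop := fun c => (c <= a)%O.

Variable G : IHfunctor.

Definition img (alpha a : A) : G alpha -> Prop :=
  fun x => exists (h : (a <= alpha)%O) (v : G a), x = Fmor h v.

(* algebraic sum  sum_{a in B} im G^a_alpha  (finite sums of elements of the
   images; the empty sum gives the zero space when B is empty) *)
Definition sum_images (alpha : A) (B : A -> Prop) : G alpha -> Prop :=
  fun x => exists s : seq (G alpha),
    (forall y, y \in s -> exists a : A, B a /\ @img alpha a y) /\
    x = \sum_(y <- s) y.

Definition Gsub (alpha : A) (B : A -> Prop) : G alpha -> Prop :=
  hclosure (@sum_images alpha B).

Definition piG (alpha : A) (B : A -> Prop) : G alpha -> G alpha :=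
  orthproj (@Gsub alpha B).

Definition intersection_property : Prop :=
  forall alpha a b : A, (a <= alpha)%O -> (b <= alpha)%O ->
    forall x : G alpha,
      @piG alpha (fun c => lower_hat a c /\ lower_hat b c) x =
      @piG alpha (lower_hat a) (@piG alpha (lower_hat b) x).

(* Decomposability.  An element of T(a) = the Hilbert direct sum of the
   S_c(a), c <= a, is represented as a family v : forall c, S_c(a) vanishing
   outside {c | c <= a} and square summable; its squared norm is the supremum
   of the finite partial sums of the nsq (v c).  phi a : G(a) -> T(a) is a
   unitary (linear, norm preserving, onto T(a)) and phi is natural. *)
Definition sq_summable_family (S : A -> IHfunctor) (a : A)
    (v : forall c : A, S c a) : Prop :=
  exists M : K, forall s : seq A, uniq s -> \sum_(c <- s) nsq (v c) <= M.

Definition family_nsq_is (S : A -> IHfunctor) (a : A)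
    (v : forall c : A, S c a) (r : K) : Prop :=
  (forall s : seq A, uniq s -> \sum_(c <- s) nsq (v c) <= r) /\
  (forall eps : K, 0 < eps -> exists s : seq A,
      uniq s /\ r - eps < \sum_(c <- s) nsq (v c)).

Definition decomposable : Prop :=
  exists (S : A -> IHfunctor)
         (phi : forall a : A, G a -> forall c : A, S c a),
    (forall (c b a : A) (h : (b <= a)%O), unitary (Fmor (i:=S c) h)) /\
    (forall (a : A) (x : G a) (c : A), ~ (c <= a)%O -> phi a x c = 0) /\
    (forall (a : A) (k : K) (x y : G a) (c : A),
        phi a (k *: x + y) c = k *: phi a x c + phi a y c) /\
    (forall (a : A) (x : G a), family_nsq_is (phi a x) (nsq x)) /\
    (forall (a : A) (v : forall c : A, S c a),
        (forall c : A, ~ (c <= a)%O -> v c = 0) ->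
        sq_summable_family v ->
        exists x : G a, forall c : A, phi a x c = v c) /\
    (* naturality: phi_a o G^b_a = T(b <= a) o phi_b *)
    (forall (b a : A) (h : (b <= a)%O) (x : G b) (c : A),
        phi a (Fmor h x) c =
        (if (c <= b)%O then Fmor (i:=S c) h (phi b x c) else 0)).

End Functor.
End Hilbert.

(* Main.v *)
(** If G is isomorphic to a direct sum of unitary functors S_c, then the closed
    subspace G^alpha(B) of a lower set B consists of the vectors whose
    coordinates outside B vanish, so its projection truncates coordinates, and
    truncating to two sets successively is truncating to their intersection.

    Conversely let S_c be the constant functor whose value is the orthogonal
    complement in G(c) of the closed sum of the images of the G(b), b < c. If c
    is not below b, then the image of S_c in G(a) is orthogonal to the whole
    image of G(b): by (I') a scalar product between the two can be computed
    after projecting to the closed sum of the images of the G(e), e <= b and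
    e <= c, all of which satisfy e < c. Hence the images of the S_c in G(a) are
    pairwise orthogonal; well-foundedness makes their sum dense, and the same
    orthogonality gives naturality of the coordinates. *)

Require Import Defs.
From HB Require Import structures.
From mathcomp Require Import all_boot all_order all_algebra.
From mathcomp Require Import boolp classical_sets reals.
From mathcomp.real_closed Require Import complex.
From mathcomp Require Import ring lra.
From Stdlib Require Import ClassicalEpsilon.

Set Implicit Arguments.
Unset Strict Implicit.
Unset Printing Implicit Defensive.

Import Order.TTheory GRing.Theory Num.Theory.
Local Open Scope ring_scope.

(* [K] is only partially ordered in the complex case; [emb] and [re] (inclusion
   of the reals and real part) let all estimates take place in [R]. *)
Record real_structure (R : realType) (K : numFieldType) (conjK : K -> K) :=
  RealStructure {
    emb : R -> K;
    re : K -> R;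
    reD : {morph re : x y / x + y};
    embK : cancel emb re;
    re_embM : forall r k, re (emb r * k) = r * re k;
    ler_emb : {mono emb : r s / r <= s};
    reK : forall x, 0 <= x -> emb (re x) = x;
    re_conj : forall x, re (conjK x) = re x;
    re_nondegenerate : forall w, (forall k, re (k * w) = 0) -> w = 0;
    conjK0 : conjK 0 = 0;
    conjKM : {morph conjK : x y / x * y}
  }.

Lemma real_structure_exists (R : realType) (K : numFieldType) (conjK : K -> K) :
  scalar_field R conjK -> inhabited (real_structure R conjK).
Proof.
case=> {K conjK}; constructor.
  apply: (@RealStructure R R idfun id id) => // w /(_ 1); by rewrite mul1r.
apply: (@RealStructure R R[i] Num.conj (real_complex R) (@complex.Re R)) => //.
- by move=> [a b] [c e].
- by move=> r [a b] /=; rewrite mul0r subr0.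
- by move=> r s; rewrite lecR.
- by move=> [a b]; rewrite lecE /= => /andP[/eqP-> _].
- by move=> [a b].
- move=> [a b] H.
  (* Testing against 1 and against i isolates the real and the imaginary part of [w]. *)
  have := H 1; have := H (Complex 0 1).
  rewrite /= !mul0r !mul1r sub0r => /eqP; rewrite oppr_eq0 => /eqP ->.
  by rewrite subr0 => ->.
- exact: conjC0.
- by move=> x y; apply: rmorphM.
Qed.

(** * Real inner products, projections and closed subspaces *)

Section RealInnerProduct.
Variables (R : realType) (K : numFieldType) (conjK : K -> K).
Variable rs : real_structure R conjK.
Local Notation re := (re rs).
Local Notation emb := (emb rs).

Lemma re0 : re 0 = 0.
Proof. by apply: (addrI (re 0)); rewrite -reD !addr0. Qed.

Lemma reN x : re (- x) = - re x.
Proof. by apply/eqP; rewrite -addr_eq0 -reD addNr re0. Qed.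

Lemma re_sum (I : Type) (s : seq I) (P : pred I) (F : I -> K) :
  re (\sum_(i <- s | P i) F i) = \sum_(i <- s | P i) re (F i).
Proof. exact: (big_morph re (reD rs) re0). Qed.

Lemma ler_re x y : 0 <= x -> 0 <= y -> (re x <= re y) = (x <= y).
Proof. by move=> x0 y0; rewrite -(ler_emb rs) !reK. Qed.

Lemma ltr_re x y : 0 <= x -> 0 <= y -> (re x < re y) = (x < y).
Proof. by move=> x0 y0; rewrite !lt_leAnge !ler_re. Qed.

Lemma re_ge0 x : 0 <= x -> 0 <= re x.
Proof. by move=> x0; rewrite -re0 ler_re. Qed.

Lemma re_gt0 x : 0 < x -> 0 < re x.
Proof. by move=> x0; rewrite -re0 ltr_re // ltW. Qed.

Lemma emb0 : emb 0 = 0.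
Proof. by rewrite -re0 reK. Qed.

Lemma emb_gt0 r : 0 < r -> 0 < emb r.
Proof. by move=> r0; rewrite lt_leAnge -emb0 !ler_emb -lt_leAnge. Qed.

Section Space.
Variable H : hilb conjK.
Implicit Types x y z : H.

Definition rip x y : R := re (hip x y).
Definition rnsq x : R := rip x x.

Lemma hip0l z : hip (0 : H) z = 0.
Proof.
have := hip_linl (-1) (0 : H) 0 z.
by rewrite scaler0 addr0 mulN1r addNr.
Qed.

Lemma hipDl x y z : hip (x + y) z = hip x z + hip y z.
Proof. by rewrite -{1}[x]scale1r hip_linl mul1r. Qed.

Lemma hipZl k x z : hip (k *: x) z = k * hip x z.
Proof. by rewrite -[k *: x]addr0 hip_linl hip0l addr0. Qed.

Lemma hipNl x z : hip (- x) z = - hip x z.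
Proof. by rewrite -scaleN1r hipZl mulN1r. Qed.

Lemma hip_sym0 x y : hip x y = 0 -> hip y x = 0.
Proof. by move=> e; rewrite hip_sym e (conjK0 rs). Qed.

Lemma ripC x y : rip x y = rip y x.
Proof. by rewrite /rip hip_sym re_conj. Qed.

Lemma rip0l z : rip (0 : H) z = 0.
Proof. by rewrite /rip hip0l re0. Qed.

Lemma rip0r z : rip z (0 : H) = 0.
Proof. by rewrite ripC rip0l. Qed.

Lemma ripDl x y z : rip (x + y) z = rip x z + rip y z.
Proof. by rewrite /rip hipDl reD. Qed.

Lemma ripNl x z : rip (- x) z = - rip x z.
Proof. by rewrite /rip hipNl reN. Qed.

Lemma ripZl r x z : rip (emb r *: x) z = r * rip x z.
Proof. by rewrite /rip hipZl re_embM. Qed.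

Lemma ripDr x y z : rip z (x + y) = rip z x + rip z y.
Proof. by rewrite !(ripC z) ripDl. Qed.

Lemma ripNr x z : rip z (- x) = - rip z x.
Proof. by rewrite !(ripC z) ripNl. Qed.

Lemma ripZr r x z : rip z (emb r *: x) = r * rip z x.
Proof. by rewrite !(ripC z) ripZl. Qed.

Definition ripE := (ripDl, ripDr, ripNl, ripNr, ripZl, ripZr).

Lemma rip_suml (I : Type) (s : seq I) (P : pred I) (F : I -> H) z :
  rip (\sum_(i <- s | P i) F i) z = \sum_(i <- s | P i) rip (F i) z.
Proof.
by apply: (big_morph (fun x => rip x z)); [move=> x y; rewrite ripDl|rewrite rip0l].
Qed.

(** A single real part loses information over the complex numbers; letting [k] range over all
    scalars recovers the full scalar product. *)
Lemma hip_eq0_rip x y : (forall k, rip (k *: x) y = 0) -> hip x y = 0.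
Proof.
by move=> xy; apply: (re_nondegenerate (r0 := rs)) => k; have := xy k; rewrite /rip hipZl.
Qed.

Lemma rip_eq0_hip x y : hip x y = 0 -> rip x y = 0.
Proof. by rewrite /rip => ->; rewrite re0. Qed.

(** Carries orthogonality proved by real estimates back to [K]: stability of [P] under scalars
    provides the multiples that [hip_eq0_rip] tests. *)
Lemma hip_orth_rip (P : H -> Prop) x : (forall k y, P y -> P (k *: y)) ->
  (forall y, P y -> rip x y = 0) -> forall y, P y -> hip x y = 0.
Proof.
move=> PZ xP y Py; apply: hip_sym0; apply: hip_eq0_rip => k.
by rewrite ripC xP //; apply: PZ.
Qed.

Lemma nsq_emb x : nsq x = emb (rnsq x).
Proof. by rewrite /rnsq /rip reK ?hip_ge0. Qed.

Lemma nsq_ge0 x : 0 <= nsq x. Proof. exact: hip_ge0. Qed.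

Lemma re_nsq x : re (nsq x) = rnsq x. Proof. by []. Qed.

Lemma rnsq_ge0 x : 0 <= rnsq x.
Proof. by rewrite re_ge0 ?hip_ge0. Qed.

Lemma rnsq0 : rnsq (0 : H) = 0. Proof. exact: rip0l. Qed.

Lemma rnsq_eq0 x : rnsq x = 0 -> x = 0.
Proof. by move=> x0; apply: hip_eq0; have := nsq_emb x; rewrite x0 emb0. Qed.

Lemma rnsqD x y : rnsq (x + y) = rnsq x + 2 * rip x y + rnsq y.
Proof. by rewrite /rnsq !ripE (ripC y x); ring. Qed.

Lemma rnsqN x : rnsq (- x) = rnsq x.
Proof. by rewrite /rnsq !ripE opprK. Qed.

Lemma rnsqB x y : rnsq (x - y) = rnsq x - 2 * rip x y + rnsq y.
Proof. by rewrite rnsqD rnsqN ripNr; ring. Qed.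

Lemma rnsqBC x y : rnsq (x - y) = rnsq (y - x).
Proof. by rewrite -opprB rnsqN. Qed.

Lemma rnsqZ r x : rnsq (emb r *: x) = r ^+ 2 * rnsq x.
Proof. by rewrite /rnsq !ripE; ring. Qed.

Lemma rnsqZK k x : rnsq (k *: x) = re (k * conjK k) * rnsq x.
Proof.
rewrite /rnsq /rip hipZl [hip x _]hip_sym hipZl (conjKM rs) -hip_sym mulrA mulrC.
by rewrite -/(nsq x) nsq_emb re_embM embK mulrC.
Qed.

(** Additivity of [emb] is not among the fields of [real_structure], so the identity is obtained by
    computing the squared norm of the difference. *)
Lemma scale_half x : emb 2^-1 *: (x + x) = x.
Proof.
apply/eqP; rewrite -subr_eq0; apply/eqP/rnsq_eq0.
by rewrite /rnsq !ripE; field.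
Qed.

Lemma rnsqD_le x y : rnsq (x + y) <= 2 * rnsq x + 2 * rnsq y.
Proof. by have := rnsq_ge0 (x - y); rewrite rnsqB rnsqD; lra. Qed.

Lemma nsq_lt_emb x eps : 0 < eps -> (nsq x < eps) = (rnsq x < re eps).
Proof. by move=> e0; rewrite -re_nsq ltr_re ?nsq_ge0 ?ltW. Qed.

Lemma hilb_complete (u : nat -> H) :
  (forall eps : R, 0 < eps -> exists N, forall m n,
     (N <= m)%N -> (N <= n)%N -> rnsq (u m - u n) < eps) ->
  exists l, forall eps : R, 0 < eps -> exists N, forall n,
     (N <= n)%N -> rnsq (u n - l) < eps.
Proof.
move=> uC; have [eps e0|l ul] := @hip_complete _ _ _ u.
  have [N NP] := uC _ (re_gt0 e0); exists N => m n Nm Nn.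
  by rewrite -/(nsq _) nsq_lt_emb //; apply: NP.
exists l => eps e0; have [N NP] := ul _ (emb_gt0 e0); exists N => n Nn.
by have := NP n Nn; rewrite -/(nsq _) nsq_lt_emb ?emb_gt0 // embK.
Qed.

End Space.

(** * Quadratic inequalities, Cauchy-Schwarz and closures *)

Lemma discriminant_le (a b c : R) : 0 <= a -> 0 <= c ->
  (forall t, 0 <= a + 2 * t * b + t ^+ 2 * c) -> b ^+ 2 <= a * c.
Proof.
move=> a0; rewrite le_eqVlt => /orP[/eqP <-|c0] P.
  have [->|b0] := eqVneq b 0; first by rewrite expr0n mulr0.
  (* For [c = 0] the polynomial is affine in [t]; this [t] gives it the value -1. *)
  have := P (- (a + 1) / (2 * b)).
  have -> : a + 2 * (- (a + 1) / (2 * b)) * b + (- (a + 1) / (2 * b)) ^+ 2 * 0 = -1.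
    by field.
  by rewrite oppr_ge0 ler10.
have := P (- b / c).
have -> : a + 2 * (- b / c) * b + (- b / c) ^+ 2 * c = (a * c - b ^+ 2) / c.
  by field; lra.
by rewrite pmulr_lge0 ?invr_gt0 // subr_ge0.
Qed.

Lemma small_le0 (a c : R) : 0 <= c -> (forall e : R, 0 < e -> a <= e * c) -> a <= 0.
Proof.
move=> c0 P; rewrite leNgt; apply/negP => a0.
have c1 : 0 < c + 1 by lra.
have := P (a / (c + 1)) (divr_gt0 a0 c1).
rewrite mulrAC ler_pdivlMr //; nra.
Qed.

Lemma exists_inv_lt (e : R) : 0 < e -> exists N, forall n, (N <= n)%N -> n.+1%:R^-1 < e.
Proof.
move=> e0; exists (Num.bound e^-1) => n Nn.
rewrite invf_plt ?posrE ?ltr0n //; apply: lt_le_trans (_ : (Num.bound e^-1)%:R <= _).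
  by apply: archi_boundP; rewrite invr_ge0 ltW.
by rewrite ler_nat leqW.
Qed.

Lemma cauchy_schwarz (H : hilb conjK) (x y : H) : rip x y ^+ 2 <= rnsq x * rnsq y.
Proof.
apply: discriminant_le; rewrite ?rnsq_ge0 // => t.
by have := rnsq_ge0 (x + emb t *: y); rewrite rnsqD rnsqZ ripZr mulrA.
Qed.

Definition approx (H : hilb conjK) (P : H -> Prop) (x : H) : Prop :=
  forall eps : R, 0 < eps -> exists y, P y /\ rnsq (x - y) < eps.

Lemma hclosure_approx (H : hilb conjK) (P : H -> Prop) x : hclosure P x <-> approx P x.
Proof.
split=> xP eps e0.
  have [y [Py]] := xP _ (emb_gt0 e0); rewrite nsq_lt_emb ?emb_gt0 // embK => xy.
  by exists y.
by have [y [Py xy]] := xP _ (re_gt0 e0); exists y; rewrite nsq_lt_emb.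
Qed.

(** By Cauchy-Schwarz the scalar product with [z] is continuous, so its vanishing passes to the
    closure. *)
Lemma approx_orth (H : hilb conjK) (P : H -> Prop) (x z : H) :
  (forall y, P y -> rip y z = 0) -> approx P x -> rip x z = 0.
Proof.
move=> Pz xP; apply/eqP; rewrite -sqrf_eq0 eq_le sqr_ge0 andbT.
apply: (small_le0 (rnsq_ge0 z)) => e e0; have [y [Py xy]] := xP _ e0.
have -> : rip x z = rip (x - y) z by rewrite ripDl ripNl (Pz y Py) subr0.
by apply: le_trans (cauchy_schwarz _ _) _; rewrite ler_wpM2r ?rnsq_ge0 ?ltW.
Qed.

(** Minimality at [t = 0] makes a quadratic polynomial without constant term nonnegative, so its
    linear coefficient vanishes. *)
Lemma rnsq_minimal_orth (H : hilb conjK) (x y : H) :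
  (forall t : R, rnsq x <= rnsq (x + emb t *: y)) -> rip x y = 0.
Proof.
move=> P; apply/eqP; rewrite -sqrf_eq0 eq_le sqr_ge0 andbT.
rewrite -(mul0r (rnsq y)); apply: discriminant_le; rewrite ?rnsq_ge0 // => t.
by have := P t; rewrite rnsqD rnsqZ ripZr; lra.
Qed.

(** * Isometries and projection onto their range *)

Section Isometry.
Variables (H1 H2 : hilb conjK) (f : H1 -> H2).
Hypothesis fI : lin_isometry f.

Lemma isoP k x y : f (k *: x + y) = k *: f x + f y. Proof. by case: fI. Qed.

Lemma isoD x y : f (x + y) = f x + f y.
Proof. by rewrite -{1}[x]scale1r isoP scale1r. Qed.

Lemma iso0 : f 0 = 0.
Proof. by apply: (addrI (f 0)); rewrite -isoD !addr0. Qed.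

Lemma isoZ k x : f (k *: x) = k *: f x.
Proof. by rewrite -[k *: x]addr0 isoP iso0 addr0. Qed.

Lemma isoN x : f (- x) = - f x.
Proof. by rewrite -scaleN1r isoZ scaleN1r. Qed.

Lemma isoB x y : f (x - y) = f x - f y.
Proof. by rewrite isoD isoN. Qed.

Lemma iso_rnsq x : rnsq (f x) = rnsq x.
Proof. by case: fI => _ /(_ x) e; rewrite -!re_nsq e. Qed.

Lemma iso_rip x y : rip (f x) (f y) = rip x y.
Proof. by have := iso_rnsq (x + y); rewrite isoD !rnsqD !iso_rnsq; lra. Qed.

(** The minimizing sequence is chosen in the domain [H1], whose completeness supplies the limit;
    this replaces a proof that the range is closed. *)
Lemma iso_projection x : exists y, forall z, hip (x - f y) (f z) = 0.
Proof.
pose D : set R := fun r => exists y, r = rnsq (x - f y).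
have D0 : has_inf D.
  split; first by exists (rnsq (x - f 0)), 0.
  by exists 0 => r [y ->]; apply: rnsq_ge0.
pose m := inf D.
have mD y : m <= rnsq (x - f y).
  by apply: ge_inf; [case: D0|exists y].
have /choice[u uP] n : exists y, rnsq (x - f y) < m + n.+1%:R^-1.
  have n0 : 0 < n.+1%:R^-1 :> R by rewrite invr_gt0 ltr0n.
  have [_ [y ->] ym] := inf_adherent n0 D0.
  by exists y.
(* Parallelogram identity: a minimizing sequence is Cauchy. *)
have uC : forall eps : R, 0 < eps -> exists N, forall p n,
     (N <= p)%N -> (N <= n)%N -> rnsq (u p - u n) < eps.
  move=> e e0; have [|N NP] := @exists_inv_lt (e / 4); first by lra.
  exists N => p n Np Nn.
  have := mD (emb 2^-1 *: (u p + u n)).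
  have h2 : x - f (emb 2^-1 *: (u p + u n)) =
            emb 2^-1 *: ((x - f (u p)) + (x - f (u n))).
    rewrite isoZ isoD addrACA -opprD scalerBr; congr (_ - _).
    by rewrite scale_half.
  rewrite h2 rnsqZ (rnsqD (x - f (u p))).
  have -> : rnsq (u p - u n) = rnsq ((x - f (u p)) - (x - f (u n))).
    by rewrite rnsqBC -iso_rnsq isoB; congr rnsq; rewrite opprB [RHS]addrC addrA subrK.
  rewrite (rnsqB (x - f (u p))); have := uP p; have := uP n; have := NP _ Np; have := NP _ Nn.
  move: (p.+1%:R^-1) (n.+1%:R^-1) (rnsq (x - f (u p))) (rnsq (x - f (u n))) => a b A B; lra.
have [l ul] := hilb_complete uC; exists l.
suff lP z : rip (x - f l) (f z) = 0.
  move=> z; apply: (@hip_orth_rip _ (fun w => exists z, w = f z)); last by exists z.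
    by move=> k _ [w ->]; exists (k *: w); rewrite isoZ.
  by move=> _ [w ->].
apply/eqP; rewrite -sqrf_eq0 eq_le sqr_ge0 andbT.
(* The scalar product will split into two terms whose squares are at most [e * rnsq z]; the 4 comes
   from [(p + q)^2 <= 2 p^2 + 2 q^2]. *)
apply: (@small_le0 _ (4 * rnsq z)); first by have := rnsq_ge0 z; lra.
move=> e e0.
have [N1 N1P] := exists_inv_lt e0; have [N2 N2P] := ul _ e0.
pose n := maxn N1 N2.
have {}N1P := N1P n (leq_maxl _ _); have {}N2P := N2P n (leq_maxr _ _).
have -> : rip (x - f l) (f z) = rip (x - f (u n)) (f z) + rip (u n - l) z.
  by rewrite -iso_rip isoB -ripDl addrA subrK.
(* [u n] is only e-minimal, so orthogonality holds up to the discriminant bound. *)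
have A : rip (x - f (u n)) (f z) ^+ 2 <= e * rnsq z.
  apply: discriminant_le; rewrite ?rnsq_ge0 ?ltW // => t.
  have := mD (u n - emb t *: z); rewrite isoB isoZ opprB addrCA addrC.
  rewrite rnsqD rnsqZ ripZr iso_rnsq; have := uP n.
  by move: (n.+1%:R^-1) N1P (rnsq (x - f (u n))) => a ae A; lra.
have B := cauchy_schwarz (u n - l) z.
have : rnsq (u n - l) * rnsq z <= e * rnsq z by rewrite ler_wpM2r ?rnsq_ge0 ?ltW.
by have := sqr_ge0 (rip (x - f (u n)) (f z) - rip (u n - l) z); nra.
Qed.

End Isometry.

(** * Closed subspaces and their orthogonal projections *)

Definition closed_subspace (H : hilb conjK) (P : H -> Prop) : Prop :=
  [/\ P 0, forall k x y, P x -> P y -> P (k *: x + y)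
    & forall x, approx P x -> P x].

Section ClosedSubspace.
Variables (H : hilb conjK) (P : H -> Prop).
Hypothesis PC : closed_subspace P.

Lemma subspace0 : P 0. Proof. by case: PC. Qed.

Lemma subspaceP k x y : P x -> P y -> P (k *: x + y).
Proof. by case: PC => _ PP _; apply: PP. Qed.

Lemma subspaceZ k x : P x -> P (k *: x).
Proof. by move=> Px; rewrite -[k *: x]addr0; apply: subspaceP => //; apply: subspace0. Qed.

Lemma subspaceD x y : P x -> P y -> P (x + y).
Proof. by move=> Px Py; rewrite -[x]scale1r; apply: subspaceP. Qed.

Lemma subspaceN x : P x -> P (- x).
Proof. by rewrite -scaleN1r; apply: subspaceZ. Qed.

Lemma subspaceB x y : P x -> P y -> P (x - y).
Proof. by move=> Px Py; apply: subspaceD => //; apply: subspaceN. Qed.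

Lemma subspace_approx x : approx P x -> P x.
Proof. by case: PC => _ _; apply. Qed.

Lemma subspace_sum (s : seq H) :
  (forall y, y \in s -> P y) -> P (\sum_(y <- s) y).
Proof.
elim: s => [|y s IH] sP; first by rewrite big_nil; apply: subspace0.
rewrite big_cons; apply: subspaceD; first by apply: sP; rewrite mem_head.
by apply: IH => z zs; apply: sP; rewrite inE zs orbT.
Qed.

Definition subspace_pred : {pred H} := fun x => `[<P x>].

Fact subspace_pred_closed : GRing.subsemimod_closed subspace_pred.
Proof.
split; first split.
- by apply/asboolP; apply: subspace0.
- by move=> x y /asboolP Px /asboolP Py; apply/asboolP; apply: subspaceD.
- by move=> k x /asboolP Px; apply/asboolP; apply: subspaceZ.
Qed.

HB.instance Definition _ :=
  GRing.isSubmodClosed.Build K H subspace_pred subspace_pred_closed.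

Definition subspace_sort := {x : H | x \in subspace_pred}.
HB.instance Definition _ := SubChoice.on subspace_sort.
HB.instance Definition _ := [SubChoice_isSubLmodule of subspace_sort by <:].

(** Reduces projection onto [P] to [iso_projection], and later turns the orthogonal complements in
    [G c] into the spaces of the decomposition. *)
Lemma subspace_hilb : exists (H' : hilb conjK) (i : H' -> H),
  lin_isometry i /\ forall x, P x <-> exists y, x = i y.
Proof.
pose ip (x y : subspace_sort) := hip (val x) (val y).
have ip_linl a x y z : ip (a *: x + y) z = a * ip x z + ip y z.
  by rewrite /ip linearP hip_linl.
have ip_sym x y : ip x y = conjK (ip y x) by rewrite /ip hip_sym.
have ip_ge0 x : 0 <= ip x x by rewrite /ip hip_ge0.
have ip_eq0 x : ip x x = 0 -> x = 0.
  by move=> /hip_eq0 x0; apply/val_inj; rewrite x0 linear0.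
have ip_complete (u : nat -> subspace_sort) :
    (forall eps : K, 0 < eps -> exists N, forall m n,
        (N <= m)%N -> (N <= n)%N -> ip (u m - u n) (u m - u n) < eps) ->
    exists l, forall eps : K, 0 < eps -> exists N, forall n,
        (N <= n)%N -> ip (u n - l) (u n - l) < eps.
  move=> uC; have [|l ul] := @hip_complete K conjK H (fun n => val (u n)).
    by move=> e /uC[N NP]; exists N => m n Nm Nn; have := NP m n Nm Nn; rewrite /ip linearB.
  have Pl : l \in subspace_pred.
    apply/asboolP; apply: subspace_approx; apply/hclosure_approx => e /ul[N NP].
    exists (val (u N)); split; first by apply/asboolP; apply: (valP (u N)).
    by rewrite nsq_emb rnsqBC -nsq_emb; apply: NP.
  by exists (exist _ l Pl) => e /ul[N NP]; exists N => n /NP; rewrite /ip linearB.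
exists (Hilb ip_linl ip_sym ip_ge0 ip_eq0 ip_complete).
exists val; split; first by split=> // a x y; rewrite linearP.
move=> x; split=> [Px|[y ->]]; last by apply/asboolP; apply: (valP y).
have xP : x \in subspace_pred by apply/asboolP.
by exists (exist _ x xP).
Qed.

(** Existence of a projection is what makes the [epsilon] in [orthproj] return one. *)
Lemma orthproj_spec x :
  P (orthproj P x) /\ forall y, P y -> hip (x - orthproj P x) y = 0.
Proof.
have E : exists p, P p /\ forall y, P y -> hip (x - p) y = 0; last first.
  exact: epsilon_spec (inhabits (0 : H)) _ E.
have [H' [i [iI iP]]] := subspace_hilb.
have [y yP] := iso_projection iI x; exists (i y); split; first by apply/iP; exists y.
by move=> _ /iP[z ->].
Qed.

Lemma orthproj_in x : P (orthproj P x). Proof. by case: (orthproj_spec x). Qed.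

Lemma rip_orthproj x y : P y -> rip (orthproj P x) y = rip x y.
Proof.
move=> Py; case: (orthproj_spec x) => _ /(_ y Py) /rip_eq0_hip.
by rewrite ripDl ripNl; lra.
Qed.

Lemma orthproj_unique x p :
  P p -> (forall y, P y -> rip (x - p) y = 0) -> orthproj P x = p.
Proof.
move=> Pp xp; apply/eqP; rewrite -subr_eq0; apply/eqP/rnsq_eq0.
have Pd : P (orthproj P x - p) by apply: subspaceB => //; apply: orthproj_in.
have := xp _ Pd; rewrite ripDl -(rip_orthproj x Pd) -ripDl.
by [].
Qed.

End ClosedSubspace.

(** * Closures of subspaces and closed spans *)

Lemma closed_subspace_approx (H : hilb conjK) (P : H -> Prop) :
  P 0 -> (forall k x y, P x -> P y -> P (k *: x + y)) -> closed_subspace (approx P).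
Proof.
move=> P0 PP; split.
- by move=> e e0; exists 0; rewrite subrr rnsq0.
- move=> k x y xP yP e e0.
  set c := re (k * conjK k).
  (* [c] is the factor by which [k] scales squared norms; adding 1 keeps the divisor positive when
     [c] is zero. *)
  have c1 : 0 < 2 * (`|c| + 1) by have := normr_ge0 c; lra.
  have e2 : 0 < e / 4 by lra.
  have [x' [Px' xx']] := xP _ (divr_gt0 e0 (mulr_gt0 (ltr0Sn _ 1) c1)).
  have [y' [Py' yy']] := yP _ e2.
  exists (k *: x' + y'); split; first exact: PP.
  rewrite opprD addrACA -scalerBr; apply: le_lt_trans (rnsqD_le _ _) _.
  rewrite rnsqZK -/c.
  have : c * rnsq (x - x') <= (`|c| + 1) * rnsq (x - x').
    by rewrite ler_wpM2r ?rnsq_ge0 //; have := ler_norm c; lra.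
  by move: xx'; rewrite ltr_pdivlMr ?mulr_gt0 //; lra.
- move=> x xP e e0; have e4 : 0 < e / 4 by lra.
  have [y [yP xy]] := xP _ e4; have [z [Pz yz]] := yP _ e4.
  exists z; split=> //; have := rnsqD_le (x - y) (y - z).
  by rewrite addrA subrK; lra.
Qed.

Definition finsum (H : hilb conjK) (I : H -> Prop) (x : H) : Prop :=
  exists s : seq H, (forall y, y \in s -> I y) /\ x = \sum_(y <- s) y.

Lemma finsum1 (H : hilb conjK) (I : H -> Prop) x : I x -> finsum I x.
Proof.
by move=> Ix; exists [:: x]; split=> [y|]; rewrite ?big_seq1 // inE => /eqP->.
Qed.

(** Since the generators are stable under scalars, their finite sums already form a linear
    subspace. *)
Lemma closed_span (H : hilb conjK) (I : H -> Prop) :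
  (forall k y, I y -> I (k *: y)) -> closed_subspace (approx (finsum I)).
Proof.
move=> IZ; apply: closed_subspace_approx; first by exists [::]; rewrite big_nil.
move=> k _ _ [s [sI ->]] [t [tI ->]]; exists ([seq k *: y | y <- s] ++ t); split.
  move=> y; rewrite mem_cat => /orP[/mapP[z zs ->]|]; last exact: tI.
  by apply: IZ; apply: sI.
by rewrite big_cat big_map scaler_sumr.
Qed.

Lemma approx_finsum_sub (H : hilb conjK) (I P : H -> Prop) :
  closed_subspace P -> (forall y, I y -> P y) -> forall x, approx (finsum I) x -> P x.
Proof.
move=> PC IP x xI; apply: (subspace_approx PC) => e /xI[_ [[s [sI ->]] xy]].
by exists (\sum_(y <- s) y); split=> //; apply: subspace_sum => // y /sI /IP.
Qed.

Lemma approx_self (H : hilb conjK) (P : H -> Prop) x : P x -> approx P x.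
Proof. by move=> Px e e0; exists x; rewrite subrr rnsq0. Qed.

Lemma closed_subspace_preim (H1 H2 : hilb conjK) (f : H1 -> H2) (P : H2 -> Prop) :
  lin_isometry f -> closed_subspace P -> closed_subspace (fun x => P (f x)).
Proof.
move=> fI PC; split; first by rewrite iso0 //; apply: subspace0.
  by move=> k x y Px Py; rewrite isoP //; apply: subspaceP.
move=> x xP; apply: (subspace_approx PC) => e /xP[y [Py xy]].
by exists (f y); rewrite -isoB // iso_rnsq.
Qed.

Lemma closed_subspace_orthogonal (H : hilb conjK) (P : H -> Prop) :
  closed_subspace P -> closed_subspace (fun x => forall y, P y -> hip x y = 0).
Proof.
move=> PC; split.
- by move=> y _; rewrite hip0l.
- by move=> k x y xP yP z Pz; rewrite hip_linl xP // yP // mulr0 addr0.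
move=> x xP; apply: hip_orth_rip => [k y|y Py]; first exact: subspaceZ.
by apply: approx_orth xP => z /(_ y Py) /rip_eq0_hip.
Qed.

(** * The closed subspaces [Gsub] generated by images *)

Section Functor.
Variables (d : Order.disp_t) (A : porderType d).

Lemma Fmor_irr (F : IHfunctor conjK A) (b a : A) (h h' : (b <= a)%O) (x : F b) :
  Fmor h x = Fmor h' x.
Proof. by rewrite (bool_irrelevance h h'). Qed.

Variable G : IHfunctor conjK A.

Lemma img_scale (alpha a : A) k (y : G alpha) : img a y -> img a (k *: y).
Proof.
by move=> [h [v ->]]; exists h, (k *: v); rewrite isoZ //; apply: Fmor_isometry.
Qed.

Lemma Gsub_span (alpha : A) (B : A -> Prop) (x : G alpha) :
  Gsub B x <-> approx (finsum (fun y => exists a, B a /\ img a y)) x.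
Proof. exact: hclosure_approx. Qed.

Lemma Gsub_closed (alpha : A) (B : A -> Prop) : closed_subspace (@Gsub _ _ _ _ G alpha B).
Proof.
have -> : @Gsub _ _ _ _ G alpha B =
          approx (finsum (fun y => exists a, B a /\ img a y)).
  by apply/funext => x; apply/propext/Gsub_span.
by apply: closed_span => k y [a [Ba ay]]; exists a; split=> //; apply: img_scale.
Qed.

Arguments Gsub_closed : clear implicits.

Lemma Gsub_min (alpha : A) (B : A -> Prop) (P : G alpha -> Prop) :
  closed_subspace P -> (forall a y, B a -> img a y -> P y) ->
  forall x, Gsub B x -> P x.
Proof.
move=> PC BP x /Gsub_span; apply: approx_finsum_sub => // y [a [Ba ay]].
exact: BP ay.
Qed.

Lemma img_Gsub (alpha a : A) (B : A -> Prop) (y : G alpha) :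
  B a -> img a y -> Gsub B y.
Proof. by move=> Ba ay; apply/Gsub_span; apply/approx_self/finsum1; exists a. Qed.

(** * Decomposable functors have the intersection property *)

Section Decomposable.
Variables (S : A -> IHfunctor conjK A) (phi : forall a : A, G a -> forall c : A, S c a).
Hypothesis SU : forall (c b a : A) (h : (b <= a)%O), unitary (Fmor (i := S c) h).
Hypothesis phi_supp : forall (a : A) (x : G a) (c : A), ~ (c <= a)%O -> phi x c = 0.
Hypothesis phiP : forall (a : A) (k : K) (x y : G a) (c : A),
  phi (k *: x + y) c = k *: phi x c + phi y c.
Hypothesis phi_nsq : forall (a : A) (x : G a), family_nsq_is (phi x) (nsq x).
Hypothesis phi_onto : forall (a : A) (v : forall c : A, S c a),
  (forall c : A, ~ (c <= a)%O -> v c = 0) -> sq_summable_family v ->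
  exists x : G a, forall c : A, phi x c = v c.
Hypothesis phi_nat : forall (b a : A) (h : (b <= a)%O) (x : G b) (c : A),
  phi (Fmor h x) c = (if (c <= b)%O then Fmor (i := S c) h (phi x c) else 0).

Lemma phiD a (x y : G a) c : phi (x + y) c = phi x c + phi y c.
Proof. by rewrite -{1}[x]scale1r phiP scale1r. Qed.

Lemma phi0 a c : phi (0 : G a) c = 0.
Proof. by apply: (addrI (phi (0 : G a) c)); rewrite -phiD !addr0. Qed.

Lemma phiZ a k (x : G a) c : phi (k *: x) c = k *: phi x c.
Proof. by rewrite -[k *: x]addr0 phiP phi0 addr0. Qed.

Lemma phiB a (x y : G a) c : phi (x - y) c = phi x c - phi y c.
Proof. by rewrite phiD -scaleN1r phiZ scaleN1r. Qed.

Lemma phi_sum_le a (x : G a) (s : seq A) :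
  uniq s -> \sum_(c <- s) rnsq (phi x c) <= rnsq x.
Proof.
move=> us; have [/(_ s us)] := phi_nsq x.
by rewrite -ler_re ?sumr_ge0 ?nsq_ge0 // ?re_sum // => c _; apply: nsq_ge0.
Qed.

Lemma phi_sum_approx a (x : G a) (e : R) : 0 < e ->
  exists s, uniq s /\ rnsq x - e < \sum_(c <- s) rnsq (phi x c).
Proof.
move=> e0; have [_ /(_ _ (emb_gt0 e0))[s [us]]] := phi_nsq x; exists s; split=> //.
have s0 : 0 <= \sum_(c <- s) nsq (phi x c) by apply: sumr_ge0 => c _; apply: nsq_ge0.
move: b; rewrite ltrBlDr -ltr_re ?nsq_ge0 ?addr_ge0 // ?ltW ?emb_gt0 //.
by rewrite reD embK re_sum ltrBlDr.
Qed.

Lemma rnsq_le_sums a (x : G a) (D : R) :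
  (forall s, uniq s -> \sum_(c <- s) rnsq (phi x c) <= D) -> rnsq x <= D.
Proof.
move=> P; apply/ler_addgt0Pr => e e0; have [s [us sx]] := phi_sum_approx x e0.
by have := P s us; lra.
Qed.

Lemma phi_inj a (x y : G a) : (forall c, phi x c = phi y c) -> x = y.
Proof.
move=> xy; apply/eqP; rewrite -subr_eq0; apply/eqP/rnsq_eq0/eqP.
rewrite eq_le rnsq_ge0 andbT; apply: rnsq_le_sums => s _.
by rewrite big1 // => c _; rewrite phiB xy subrr rnsq0.
Qed.

Lemma phi_surj a (v : forall c, S c a) (M : R) :
  (forall c : A, ~ (c <= a)%O -> v c = 0) ->
  (forall s, uniq s -> \sum_(c <- s) rnsq (v c) <= M) ->
  exists x : G a, forall c : A, phi x c = v c.
Proof.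
move=> v0 vM; apply: phi_onto => //; exists (emb M) => s us.
have s0 : 0 <= \sum_(c <- s) nsq (v c) by apply: sumr_ge0 => c _; apply: nsq_ge0.
by rewrite -(reK rs s0) ler_emb re_sum; apply: vM.
Qed.

(** Truncation keeps a family square summable, so surjectivity of [phi] provides the vector. *)
Lemma phi_truncate a (x : G a) (B : A -> Prop) :
  exists p : G a, forall c, phi p c = if `[<B c>] then phi x c else 0.
Proof.
apply: (@phi_surj _ _ (rnsq x)) => [c ca|s us]; first by case: ifP => // _; apply: phi_supp.
apply: le_trans (phi_sum_le x us); apply: ler_sum => c _.
by case: ifP => // _; rewrite rnsq0 rnsq_ge0.
Qed.

(** Unitarity of [S c] pulls the coordinate back to level [c], surjectivity there gives a vector of
    [G c] with this one coordinate, and naturality pushes it forward to [alpha]. *)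
Lemma phi_component alpha (x : G alpha) c : (c <= alpha)%O ->
  exists y, img c y /\ forall c', phi y c' = if c' == c then phi x c' else 0.
Proof.
move=> h.
(* Stated for every [c'], so that the dependent family [v] needs no transport along [c' = c]. *)
have ex c' : exists w : S c' c, Fmor h w = phi x c'.
  by have [_ [g _ gK]] := SU c' h; exists (g (phi x c')).
pose v c' : S c' c := if c' == c then sval (cid (ex c')) else 0.
have [|s us|w wv] := @phi_surj c v (rnsq (v c)).
- by move=> c' cc'; rewrite /v; case: eqP => // e; rewrite e lexx in cc'.
- have v0 c' : c' != c -> rnsq (v c') = 0 by rewrite /v => /negPf ->; apply: rnsq0.
  have [cs|cs] := boolP (c \in s).
    by rewrite (bigD1_seq c) //= big1 ?addr0.
  rewrite big1_seq ?rnsq_ge0 // => c' /andP[_ c's]; apply: v0.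
  by apply: contraNneq cs => <-.
exists (Fmor h w); split; first by exists h, w.
move=> c'; rewrite phi_nat wv /v; case: eqP => [->|_].
  by rewrite lexx; case: cid.
by case: ifP => // _; rewrite iso0 //; apply: Fmor_isometry.
Qed.

Lemma phi_partial_sum alpha (B : A -> Prop) (x : G alpha) (s : seq A) :
  (forall b, B b -> (b <= alpha)%O) -> uniq s -> (forall c, c \in s -> B c) ->
  exists y, finsum (fun y => exists a, B a /\ img a y) y /\
    forall c, phi y c = if c \in s then phi x c else 0.
Proof.
move=> Ba; elim: s => [|c s IH] /=.
  exists 0; split; first by exists [::]; rewrite big_nil.
  by move=> c; rewrite phi0.
move=> /andP[cs us] sB; have [|y [[t [tI yt]] yP]] := IH us.
  by move=> b bs; apply: sB; rewrite inE bs orbT.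
have Bc : B c by apply: sB; rewrite mem_head.
have [z [zc zP]] := phi_component x (Ba _ Bc).
exists (z + y); split.
  exists (z :: t); rewrite big_cons -yt; split=> // w.
  by rewrite inE => /orP[/eqP->|]; [exists c|apply: tI].
move=> b; rewrite phiD zP yP inE; case: (eqVneq b c) => [->|_] /=; last by rewrite add0r.
by rewrite (negPf cs) addr0.
Qed.

(** Vanishing of the coordinate [c] is a closed linear condition. Naturality gives it on the image
    of [G a], [a] in [B], because [c <= a] would put [c] in the lower set. *)
Lemma phi_Gsub alpha (B : A -> Prop) (x : G alpha) :
  (forall b c, (c <= b)%O -> B b -> B c) -> Gsub B x ->
  forall c, ~ B c -> phi x c = 0.
Proof.
move=> Bl xB c Bc; apply: (@Gsub_min _ _ (fun x => phi x c = 0) _ _ x xB); last first.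
  move=> a _ Ba [h [v ->]]; rewrite phi_nat; case: ifP => // ca.
  by case: Bc; apply: Bl Ba.
split; first exact: phi0.
  by move=> k y z yc zc; rewrite phiP yc zc scaler0 addr0.
move=> y yP; apply: rnsq_eq0; apply/eqP; rewrite eq_le rnsq_ge0 andbT.
apply: (@small_le0 _ 1) => // e /yP[z [zc yz]]; rewrite mulr1; apply/ltW.
apply: le_lt_trans yz; rewrite -[phi y c]subr0 -zc -phiB.
by have := @phi_sum_le _ (y - z) [:: c] isT; rewrite big_seq1.
Qed.

(** Finitely many coordinates carry all but [e] of the squared norm; those in [B] are assembled into
    a finite sum of images. *)
Lemma Gsub_phi alpha (B : A -> Prop) (x : G alpha) :
  (forall b, B b -> (b <= alpha)%O) ->
  (forall c, ~ B c -> phi x c = 0) -> Gsub B x.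
Proof.
move=> Ba xB; apply/Gsub_span => e e0; have [s [us xs]] := phi_sum_approx x e0.
pose t := [seq c <- s | `[<B c>]].
have ut : uniq t by apply: filter_uniq.
have [|y [yB yP]] := phi_partial_sum x Ba ut.
  by move=> c; rewrite mem_filter => /andP[/asboolP].
exists y; split=> //.
apply: le_lt_trans (_ : rnsq x - \sum_(c <- s) rnsq (phi x c) < e); last first.
  by lra.
apply: rnsq_le_sums => u uu; rewrite lerBrDr.
have -> : \sum_(c <- s) rnsq (phi x c) = \sum_(c <- t) rnsq (phi x c).
  rewrite big_filter (bigID (fun c => `[<B c>])) /= [X in _ + X]big1 ?addr0 //.
  by move=> c /asboolP Bc; rewrite xB // rnsq0.
have -> : \sum_(c <- u) rnsq (phi (x - y) c) = \sum_(c <- u | c \notin t) rnsq (phi x c).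
  rewrite [RHS]big_mkcond; apply: eq_bigr => c _; rewrite phiB yP.
  by case: (c \in t); rewrite ?subrr ?subr0 ?rnsq0.
(* The indices of [u] outside [t], followed by [t], form one duplicate-free list, so a single
   partial sum bounds both. *)
rewrite -big_filter -big_cat; apply: phi_sum_le.
rewrite cat_uniq filter_uniq // ut andbT /=.
by apply/hasPn => c ct; rewrite mem_filter ct.
Qed.

(** The hypotheses on [phi] speak of norms only, so orthogonality is obtained from minimality:
    adding a vector supported in [B] to [x - p], which vanishes on [B], leaves the coordinates
    outside [B] unchanged. *)
Lemma piG_phi alpha (B : A -> Prop) (x : G alpha) c :
  (forall b, B b -> (b <= alpha)%O) -> (forall b c, (c <= b)%O -> B b -> B c) ->
  phi (piG B x) c = if `[<B c>] then phi x c else 0.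
Proof.
move=> Ba Bl; have [p pP] := phi_truncate x B.
suff -> : piG B x = p by rewrite pP.
rewrite /piG; apply: orthproj_unique; first exact: Gsub_closed.
  by apply: Gsub_phi => // b Bb; rewrite pP; case: asboolP.
move=> y yB; apply: rnsq_minimal_orth => t; apply: rnsq_le_sums => s us.
apply: le_trans (phi_sum_le _ us); apply: ler_sum => b _.
rewrite phiD phiZ phiB pP; case: asboolP => Bb; first by rewrite subrr rnsq0 rnsq_ge0.
by rewrite (phi_Gsub Bl yB Bb) scaler0 addr0.
Qed.

Lemma decomposable_intersection : intersection_property G.
Proof.
move=> alpha a b ha hb x; apply: phi_inj => c.
have hatP e : (e <= alpha)%O -> forall f, lower_hat e f -> (f <= alpha)%O.
  by move=> he f fe; apply: le_trans he.
have hatl e f g : (g <= f)%O -> lower_hat e f -> lower_hat e g by apply: le_trans.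
rewrite !piG_phi; try by [apply: hatP | move=> f g; apply: hatl | move=> f [/(hatP _ ha)]].
  by rewrite asbool_and; case: `[<lower_hat a c>]; case: `[<lower_hat b c>].
by move=> f g gf [af bf]; split; apply: hatl gf _.
Qed.

End Decomposable.

Definition const_functor (H : hilb conjK) : IHfunctor conjK A.
Proof.
by exists (fun=> H) (fun _ _ _ => id).
Defined.

(** * Functors with the intersection property are decomposable *)

Section Converse.
Hypothesis wfA : well_founded_poset A.
Hypothesis capG : intersection_property G.

(** Below every counterexample lies another; iterating a choice of them would give an infinite
    descent. *)
Lemma wf_ind (P : A -> Prop) :
  (forall a, (forall b, (b < a)%O -> P b) -> P a) -> forall a, P a.
Proof.
move=> IH a0; apply: contrapT => a0P.
have /choice[f fP] (x : {a | ~ P a}) : exists y : {a | ~ P a}, (sval y < sval x)%O.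
  apply: contrapT => nex; apply: (svalP x); apply: IH => b bx.
  by apply: contrapT => nPb; apply: nex; exists (exist _ b nPb).
by apply: (wfA (f := fun n => sval (iter n f (exist _ a0 a0P)))) => n; apply: fP.
Qed.

Definition new_part (c : A) (x : G c) : Prop :=
  forall y, Gsub (fun b => (b < c)%O) y -> hip x y = 0.

(** * Coordinates along the new parts *)

Section Coordinates.
Variables (S0 : A -> hilb conjK) (i : forall c, S0 c -> G c).
Arguments i {c}.
Hypothesis iI : forall c, lin_isometry (@i c).
Hypothesis iP : forall c (x : G c), new_part x <-> exists y, x = i y.

(** Made total by the default 0, so that sums and families can range over all of [A]; matching on
    [idP] supplies the order proof that [Fmor] requires. *)
Definition emb_new (a c : A) (z : S0 c) : G a :=
  if @idP (c <= a)%O is ReflectT h then Fmor h (i z) else 0.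
Arguments emb_new a {c}.

Lemma emb_newE a c (h : (c <= a)%O) (z : S0 c) : emb_new a z = Fmor h (i z).
Proof. by rewrite /emb_new; case: {-}_ / idP => // h'; apply: Fmor_irr. Qed.

Lemma emb_new0 a c (z : S0 c) : ~ (c <= a)%O -> emb_new a z = 0.
Proof. by rewrite /emb_new; case: {-}_ / idP. Qed.

Lemma emb_new_isometry a c : (c <= a)%O -> lin_isometry (@emb_new a c).
Proof.
move=> h; have hI : lin_isometry (Fmor (i := G) h) by apply: Fmor_isometry.
split=> [k x y|x]; rewrite !(emb_newE h).
  by rewrite !isoP.
by rewrite !nsq_emb !iso_rnsq.
Qed.

Lemma Fmor_emb_new (b a c : A) (h : (b <= a)%O) (z : S0 c) : (c <= b)%O ->
  Fmor h (emb_new b z) = emb_new a z.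
Proof.
move=> cb; have ca := le_trans cb h.
by rewrite (emb_newE cb) (emb_newE ca) (Fmor_comp cb h).
Qed.

(** The one place where the intersection property enters; all orthogonality between coordinates
    derives from it. *)
Lemma emb_new_orth (a b c : A) (h : (b <= a)%O) (x : G b) (z : S0 c) :
  ~ (c <= b)%O -> rip (Fmor h x) (emb_new a z) = 0.
Proof.
move=> cb; have [ca|/negP ca] := boolP (c <= a)%O; last by rewrite emb_new0 ?rip0r.
have xb : Gsub (lower_hat b) (Fmor h x).
  by apply: (@img_Gsub _ b); [apply: lexx|exists h, x].
have zc : Gsub (lower_hat c) (emb_new a z).
  by apply: (@img_Gsub _ c); [apply: lexx|exists ca, (i z); apply: emb_newE].
have e := capG ca h (Fmor h x).
(* Projecting to the subspace of [c] preserves the scalar product with the embedded [z], and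
   projecting to that of [b] fixes [Fmor h x]; so the product of both projections can be
   inserted. *)
rewrite -(rip_orthproj (Gsub_closed _ _) _ zc) -/(piG _ _).
have xfix : piG (lower_hat b) (Fmor h x) = Fmor h x.
  rewrite /piG; apply: orthproj_unique => [|//|y _]; first exact: Gsub_closed.
  by rewrite subrr rip0l.
rewrite -[X in piG _ X]xfix -e.
have := orthproj_in (@Gsub_closed a (fun c0 => lower_hat c c0 /\ lower_hat b c0)) (Fmor h x).
rewrite -/(piG _ _); move: (piG _ _) => y yP.
pose I y' := exists a', (lower_hat c a' /\ lower_hat b a') /\ @img _ _ _ _ G a a' y'.
apply: (@approx_orth _ (finsum I)) => [w|]; last exact/Gsub_span.
move=> [s [sI ->]]; rewrite rip_suml big1_seq // => {}w /andP[_ /sI[a' [[ca' ba'] [h' [v ->]]]]].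
(* Equality [a' = c] would give [c <= b]. Strictness is what lets [new_part] apply. *)
have a'c : (a' < c)%O by rewrite lt_neqAle; apply/andP; split=> //; apply: contra_notN cb => /eqP <-.
rewrite (emb_newE ca) (Fmor_comp (ltW a'c) ca) iso_rip; last exact: Fmor_isometry.
rewrite ripC; apply: rip_eq0_hip.
have /iP zN : exists y, i z = i y by exists z.
apply: zN.
by apply: (@img_Gsub _ a') => //; exists (ltW a'c), v.
Qed.


(** When [c] is not below [a], [emb_new a] is zero and the first condition is empty; the second then
    fixes the value 0. *)
Lemma coordinate_exists a c (x : G a) : exists y : S0 c,
  (forall z : S0 c, hip (x - emb_new a y) (emb_new a z) = 0) /\ (~ (c <= a)%O -> y = 0).
Proof.
have [ca|/negP ca] := boolP (c <= a)%O.
  by have [y yP] := iso_projection (emb_new_isometry ca) x; exists y; split.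
by exists 0; split=> // z; rewrite (emb_new0 z) //; apply: hip_sym0; rewrite hip0l.
Qed.

Definition coord a (x : G a) c : S0 c := sval (cid (coordinate_exists c x)).

Lemma coord_hip a (x : G a) c (z : S0 c) : hip (x - emb_new a (coord x c)) (emb_new a z) = 0.
Proof. by rewrite /coord; case: cid => y []. Qed.

Lemma coord0 a (x : G a) c : ~ (c <= a)%O -> coord x c = 0.
Proof. by rewrite /coord; case: cid => y []. Qed.

(** Taking the coordinate is adjoint to the isometric embedding, as the residual is orthogonal to
    its range. *)
Lemma coord_rip a (x : G a) c (z : S0 c) : rip x (emb_new a z) = rip (coord x c) z.
Proof.
have [ca|/negP ca] := boolP (c <= a)%O; last by rewrite emb_new0 // coord0 // rip0l rip0r.
have /rip_eq0_hip := coord_hip x z; rewrite ripDl ripNl (iso_rip (emb_new_isometry ca)).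
by lra.
Qed.

Lemma coord_unique a (x : G a) c (y : S0 c) : (~ (c <= a)%O -> y = 0) ->
  (forall z : S0 c, rip x (emb_new a z) = rip y z) -> coord x c = y.
Proof.
move=> y0 yP; have [ca|/negP ca] := boolP (c <= a)%O; last by rewrite coord0 // y0.
apply/eqP; rewrite -subr_eq0; apply/eqP/rnsq_eq0.
by rewrite /rnsq ripDl ripNl -coord_rip yP subrr.
Qed.

Lemma coordP a k (x y : G a) c : coord (k *: x + y) c = k *: coord x c + coord y c.
Proof.
apply: coord_unique => [ca|z]; first by rewrite !coord0 // scaler0 addr0.
have [ca|/negP ca] := boolP (c <= a)%O; last first.
  by rewrite emb_new0 // !coord0 // scaler0 addr0 rip0l rip0r.
have eI := emb_new_isometry ca.
rewrite -(iso_rip eI) isoP //; apply/eqP; rewrite -subr_eq0 -ripNl -ripDl opprD addrACA -scalerBr.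
by apply/eqP/rip_eq0_hip; rewrite hip_linl !coord_hip mulr0 addr0.
Qed.

Lemma coordD a (x y : G a) c : coord (x + y) c = coord x c + coord y c.
Proof. by rewrite -{1}[x]scale1r coordP scale1r. Qed.

Lemma coordB a (x y : G a) c : coord (x - y) c = coord x c - coord y c.
Proof. by rewrite addrC -scaleN1r coordP scaleN1r addrC. Qed.

(** By antisymmetry one of [b], [c] is not below the other, and [emb_new_orth] applies in that
    direction. *)
Lemma coord_emb_new a b c (z : S0 c) : (c <= a)%O -> (b <= a)%O -> b != c ->
  coord (emb_new a z) b = 0.
Proof.
move=> ca ba bc; apply: coord_unique => // w; rewrite rip0l.
have [cb|/negP cb] := boolP (c <= b)%O.
  rewrite (emb_newE ca) emb_new_orth // => bc'.
  by move: bc; rewrite eq_le bc' cb.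
by rewrite ripC (emb_newE ba) emb_new_orth.
Qed.

Lemma coord_emb_new_id a c (z : S0 c) : (c <= a)%O -> coord (emb_new a z) c = z.
Proof.
move=> ca; apply: coord_unique => // w; rewrite iso_rip //; exact: emb_new_isometry.
Qed.

Lemma coord_Fmor (b a : A) (h : (b <= a)%O) (x : G b) (c : A) :
  coord (Fmor h x) c = if (c <= b)%O then coord x c else 0.
Proof.
case: ifPn => [cb|/negP cb]; apply: coord_unique => //.
- by move=> ca; case: ca; apply: le_trans h.
- move=> z; rewrite -(Fmor_emb_new h z cb) iso_rip; last exact: Fmor_isometry.
  exact: coord_rip.
by move=> z; rewrite emb_new_orth // rip0l.
Qed.

(** * Finite partial sums, Bessel and Parseval *)

Section PartialSums.
Variables (a : A) (v : forall c, S0 c).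
Hypothesis v0 : forall c, ~ (c <= a)%O -> v c = 0.

Definition psum (s : seq A) : G a := \sum_(c <- s) emb_new a (v c).

Lemma rip_psum x s : rip x (psum s) = \sum_(c <- s) rip (coord x c) (v c).
Proof.
by rewrite ripC rip_suml; apply: eq_bigr => c _; rewrite ripC coord_rip.
Qed.

Lemma coord_psum s c : uniq s -> coord (psum s) c = if c \in s then v c else 0.
Proof.
have coord00 : coord (0 : G a) c = 0 by rewrite -[0 : G a](subrr 0) coordB subrr.
elim: s => [|b s IH] /=; first by rewrite /psum big_nil.
move=> /andP[bs us]; rewrite /psum big_cons coordD IH // inE.
have [ca|/negP ca] := boolP (c <= a)%O; last first.
  by rewrite coord0 // v0 //; case: ifP; case: ifP; rewrite addr0.
have [eb|cb] := eqVneq c b; first by subst b; rewrite coord_emb_new_id // (negPf bs) addr0.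
have [ba|/negP ba] := boolP (b <= a)%O; first by rewrite coord_emb_new // add0r.
by rewrite emb_new0 // coord00 add0r.
Qed.

Lemma rip_psum_subset s t : uniq t -> {subset s <= t} ->
  rip (psum t) (psum s) = \sum_(c <- s) rnsq (v c).
Proof.
move=> ut st; rewrite rip_psum !big_seq; apply: eq_bigr => c cs.
by rewrite coord_psum // st.
Qed.

Lemma rnsq_psum s : uniq s -> rnsq (psum s) = \sum_(c <- s) rnsq (v c).
Proof. by move=> us; apply: rip_psum_subset. Qed.

End PartialSums.

Lemma rnsq_residual a (x : G a) s : uniq s ->
  rnsq (x - psum a (coord x) s) = rnsq x - \sum_(c <- s) rnsq (coord x c).
Proof.
move=> us; rewrite rnsqB rnsq_psum //; last exact: coord0.
rewrite rip_psum /rnsq; lra.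
Qed.

Lemma bessel a (x : G a) s : uniq s -> \sum_(c <- s) rnsq (coord x c) <= rnsq x.
Proof. by move=> us; have := rnsq_ge0 (x - psum a (coord x) s); rewrite rnsq_residual //; lra. Qed.

Lemma coord_le a (x : G a) c : rnsq (coord x c) <= rnsq x.
Proof. by have := @bessel a x [:: c] isT; rewrite big_seq1. Qed.

Definition new_vector a (y : G a) := exists c (z : S0 c), y = emb_new a z.

Lemma closed_new_span a : closed_subspace (approx (finsum (@new_vector a))).
Proof.
apply: closed_span => k _ [c [z ->]]; exists c, (k *: z).
have [ca|/negP ca] := boolP (c <= a)%O; last by rewrite !emb_new0 // scaler0.
by rewrite isoZ //; apply: emb_new_isometry.
Qed.

(** Each vector of [G b] is a new vector plus one in the closed span of images from strictly below
    [b], to which the induction hypothesis applies. *)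
Lemma new_part_dense a (x : G a) : approx (finsum (@new_vector a)) x.
Proof.
(* The target [a] stays fixed while the source [b] varies, so the induction takes place inside one
   closed subspace of [G a]. *)
suff H : forall b (h : (b <= a)%O) (y : G b), approx (finsum (@new_vector a)) (Fmor h y).
  by rewrite -(Fmor_id (lexx a) x).
elim/wf_ind => b IH h y.
pose n := orthproj (Gsub (fun c => (c < b)%O)) y.
have [nN yn] := orthproj_spec (Gsub_closed _ (fun c => (c < b)%O)) y.
have hI : lin_isometry (Fmor (i := G) h) by apply: Fmor_isometry.
have /iP[z yz] : new_part (y - n) by [].
rewrite -(subrK n y) (isoD hI); apply: (subspaceD (closed_new_span a)).
  by apply/approx_self/finsum1; exists b, z; rewrite (emb_newE h) yz.
apply: (@Gsub_min _ _ (fun y => approx (finsum (@new_vector a)) (Fmor h y)) _ _ n nN).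
  exact: closed_subspace_preim (closed_new_span a).
move=> c _ cb [hcb [w ->]]; rewrite -(Fmor_comp hcb h (le_trans hcb h)).
exact: IH.
Qed.

Lemma finsum_new_support a (y : G a) : finsum (@new_vector a) y ->
  exists s, uniq s /\ forall u : G a, (forall c, c \in s -> coord u c = 0) -> rip u y = 0.
Proof.
move=> [t [+ ->]]; elim: t => [|z0 t IH] tI.
  by exists [::]; split=> // u _; rewrite big_nil rip0r.
have [|s [us sP]] := IH; first by move=> z zt; apply: tI; rewrite inE zt orbT.
have [c [z e]] := tI _ (mem_head _ _).
exists (undup (c :: s)); split=> [|u uP]; first exact: undup_uniq.
rewrite big_cons ripDr sP => [|b bs]; last by apply: uP; rewrite mem_undup inE bs orbT.
by rewrite e coord_rip uP ?rip0l ?addr0 // mem_undup mem_head.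
Qed.

(** On the finite support of an approximant [y], the partial sum [w] of [x] is at least as close to
    [x] as [y]: the residual is orthogonal to both. *)
Lemma parseval_approx a (x : G a) (e : R) : 0 < e ->
  exists s, uniq s /\ rnsq x - e < \sum_(c <- s) rnsq (coord x c).
Proof.
move=> /(@new_part_dense a x)[y [yF xy]].
have [s [us sP]] := finsum_new_support yF; exists s; split=> //.
pose w := psum a (coord x) s; pose r := x - w.
have r0 c : c \in s -> coord r c = 0.
  by move=> cs; rewrite coordB coord_psum ?cs ?subrr //; apply: coord0.
have rw : rip r w = 0 by rewrite rip_psum big1_seq // => c /andP[_ /r0 ->]; apply: rip0l.
have : rnsq r <= rnsq (x - y).
  have -> : x - y = r + (w - y) by rewrite /r addrA subrK.
  by rewrite rnsqD ripDr ripNr rw (sP r r0) oppr0 addr0 mulr0 addr0 lerDl rnsq_ge0.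
by rewrite /r /w rnsq_residual //; lra.
Qed.

Lemma coord_onto a (v : forall c, S0 c) (M : R) :
  (forall c, ~ (c <= a)%O -> v c = 0) ->
  (forall s, uniq s -> \sum_(c <- s) rnsq (v c) <= M) ->
  exists x : G a, forall c, coord x c = v c.
Proof.
move=> v0 vM; pose q s := \sum_(c <- s) rnsq (v c).
pose D : set R := fun r => exists s, uniq s /\ r = q s.
have D0 : has_sup D.
  split; first by exists (q [::]), [::].
  by exists M => _ [s [us ->]]; apply: vM.
pose m := sup D.
have qm s : uniq s -> q s <= m.
  by move=> us; apply: ub_le_sup; [case: D0|exists s].
(* The index set may be uncountable: finite sets nearly exhausting the total mass
   give a Cauchy sequence of partial sums. *)
have /choice[s sP] n : exists s, uniq s /\ m - n.+1%:R^-1 < q s.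
  have n0 : 0 < n.+1%:R^-1 :> R by rewrite invr_gt0 ltr0n.
  by have [_ [s [us ->]] sm] := sup_adherent n0 D0; exists s.
have us n : uniq (s n) by case: (sP n).
(* The squared distance is the added mass [q u - q t], and [q u] is at most [m]. *)
have dist t u : uniq t -> uniq u -> {subset t <= u} ->
    rnsq (psum a v u - psum a v t) <= m - q t.
  move=> ut uu tu; rewrite rnsqB !rnsq_psum // rip_psum_subset // -/(q u) -/(q t).
  by have := qm u uu; lra.
have uC (e : R) : 0 < e -> exists N, forall k n, (N <= k)%N -> (N <= n)%N ->
    rnsq (psum a v (s k) - psum a v (s n)) < e.
  move=> e0; have [|N NP] := @exists_inv_lt (e / 4); first by lra.
  exists N => k n Nk Nn; pose u := undup (s k ++ s n).
  have uu : uniq u by apply: undup_uniq.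
  have dk : rnsq (psum a v u - psum a v (s k)) <= m - q (s k).
    by apply: dist => // c cs; rewrite mem_undup mem_cat cs.
  have dn : rnsq (psum a v u - psum a v (s n)) <= m - q (s n).
    by apply: dist => // c cs; rewrite mem_undup mem_cat cs orbT.
  rewrite rnsqBC in dk; have := rnsqD_le (psum a v (s k) - psum a v u) (psum a v u - psum a v (s n)).
  rewrite addrA subrK; have [_] := sP k; have [_] := sP n.
  by move: (n.+1%:R^-1) (NP n Nn) (k.+1%:R^-1) (NP k Nk) => ? ? ? ?; lra.
have [x xP] := hilb_complete uC; exists x => c.
apply/eqP; rewrite -subr_eq0; apply/eqP/rnsq_eq0/eqP; rewrite eq_le rnsq_ge0 andbT.
apply: (@small_le0 _ 4) => // e e0.
have [N1 N1P] := exists_inv_lt e0; have [N2 N2P] := xP _ e0.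
pose n := maxn N1 N2.
have {}N1P := N1P n (leq_maxl _ _); have {}N2P := N2P n (leq_maxr _ _).
have A1 : rnsq (coord x c - coord (psum a v (s n)) c) < e.
  by rewrite -coordB; apply: le_lt_trans (coord_le _ _) _; rewrite rnsqBC.
have A2 : rnsq (coord (psum a v (s n)) c - v c) <= e.
  rewrite coord_psum //; have [cs|cs] := boolP (c \in s n).
    by rewrite subrr rnsq0 ltW.
  (* An index missed by [s n] carries mass below [e], since adding it cannot push the total above
     [m]. *)
  rewrite sub0r rnsqN; have := qm (c :: s n); rewrite /= cs us /q big_cons => /(_ isT).
  have [_] := sP n; rewrite /q.
  by move: (n.+1%:R^-1) N1P => ? ?; lra.
have := rnsqD_le (coord x c - coord (psum a v (s n)) c) (coord (psum a v (s n)) c - v c).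
by rewrite addrA subrK; lra.
Qed.

Lemma coord_decomposable : decomposable G.
Proof.
exists (fun c => const_functor (S0 c)), coord; split.
  by move=> c b a h; split; [split|exists id].
split; first exact: coord0.
split; first exact: coordP.
have sum_ge0 (s : seq A) (v : forall c, S0 c) : 0 <= \sum_(c <- s) nsq (v c).
  by apply: sumr_ge0 => c _; apply: nsq_ge0.
split.
  move=> a x; split=> [s us|e e0].
    by rewrite -ler_re ?nsq_ge0 // re_sum; apply: bessel.
  have [s [us sx]] := parseval_approx x (re_gt0 e0); exists s; split=> //.
  rewrite ltrBlDr -ltr_re ?nsq_ge0 ?addr_ge0 // ?ltW //.
  by rewrite reD re_sum -ltrBlDr.
split; last exact: coord_Fmor.
move=> a v v0 [M vM]; apply: (@coord_onto a v (re M)) => // s us.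
(* The order of [K] may be partial; the empty sum shows that [M] is a nonnegative real. *)
have M0 : 0 <= M by have := vM [::] isT; rewrite big_nil.
by rewrite -re_sum ler_re //; [apply: vM | apply: sum_ge0].
Qed.

End Coordinates.

Lemma closed_new_part c : closed_subspace (@new_part c).
Proof. exact/closed_subspace_orthogonal/Gsub_closed. Qed.

Lemma intersection_decomposable : decomposable G.
Proof.
(* [X] chooses a Hilbert space for each new part and [Y] its isometric inclusion into [G c]. *)
pose X c := cid (subspace_hilb (closed_new_part c)).
pose Y c := cid (svalP (X c)).
apply: (@coord_decomposable (fun c => sval (X c)) (fun c => sval (Y c))) => c.
  by case: (svalP (Y c)).
by case: (svalP (Y c)).
Qed.

End Converse.
End Functor.
End RealInnerProduct.

Theorem theorem4p1 (R : realType) (K : numFieldType) (conjK : K -> K)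
  (HK : scalar_field R conjK)
  (d : Order.disp_t) (A : porderType d) (G : IHfunctor conjK A) :
  well_founded_poset A ->
  (decomposable G <-> intersection_property G).
Proof.
move=> wfA; have [rs] := real_structure_exists HK.
split; last exact: (intersection_decomposable rs).
by move=> [S [phi [? [? [? [? [? ?]]]]]]]; apply: (@decomposable_intersection _ _ _ rs _ _ _ S phi).
Qed.
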